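(* Let $M,H\in\mathbb{R}_{\max}^{d\times d}$. Then for all $k\geq 2$ the $k$-th semidirect power of the pair $(M,H)$ is $$(M,H)^k=\left(\Big(M\otimes\bigoplus_{i=0}^{k-1}H^{\otimes i}\Big)\oplus\Big(H\otimes\bigoplus_{i=0}^{k-2}H^{\otimes i}\Big),\ H^{\circ k}\right).$$
   Context: $\mathbb{R}_{\max}=\mathbb{R}\cup\{-\infty\}$ with $a\oplus b=\max(a,b)$, $a\otimes b=a+b$; matrix operations: $(A\oplus B)_{ij}=a_{ij}\oplus b_{ij}$, $(A\otimes B)_{ij}=\bigoplus_k a_{ik}\otimes b_{kj}$; $A^{\otimes i}$ is the $i$-th power with respect to $\otimes$, with $A^{\otimes 0}=I$ (the tropical identity: $0$ on the diagonal, $-\infty$ off it). The adjoint product of $d\times d$ matrices is $A\circ B=A\oplus B\oplus (A\otimes B)$; adjoint powers are $A^{\circ 1}=A$, $A^{\circ(k+1)}=A^{\circ k}\circ A$. The semidirect product of pairs of $d\times d$ matrices is $(M,G)(A,H)=((M\circ H)\oplus A,\ G\circ H)$, and semidirect powers are $(M,H)^1=(M,H)$, $(M,H)^{k+1}=(M,H)^k(M,H)$. *)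

(* Defs.v *)
From HB Require Import structures.
From mathcomp Require Import all_boot all_order all_algebra.
From mathcomp Require Import reals.

Set Implicit Arguments.
Unset Strict Implicit.
Unset Printing Implicit Defensive.

Import Order.TTheory GRing.Theory Num.Theory.

Local Open Scope ring_scope.

(* The max-plus semiring R u {-oo}; [None] is -oo. *)
Definition tropical (R : realType) : Type := option R.

HB.instance Definition _ (R : realType) := Choice.on (tropical R).

Section TropicalSemiring.
Variable R : realType.
Implicit Types a b c : tropical R.

Definition trop_add a b : tropical R :=
  match a, b with
  | None, _ => b
  | _, None => a
  | Some x, Some y => Some (Num.max x y)
  end.

Definition trop_mul a b : tropical R :=
  match a, b with
  | Some x, Some y => Some (x + y)
  | _, _ => None
  end.

Fact trop_addA : associative trop_add.
Proof. by move=> [x|] [y|] [z|] //=; rewrite maxA. Qed.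

Fact trop_addC : commutative trop_add.
Proof. by move=> [x|] [y|] //=; rewrite maxC. Qed.

Fact trop_add0 : left_id None trop_add.
Proof. by case. Qed.

Fact trop_mulA : associative trop_mul.
Proof. by move=> [x|] [y|] [z|] //=; rewrite addrA. Qed.

Fact trop_mulC : commutative trop_mul.
Proof. by move=> [x|] [y|] //=; rewrite addrC. Qed.

Fact trop_mul1 : left_id (Some 0) trop_mul.
Proof. by case=> [x|] //=; rewrite add0r. Qed.

Fact trop_mulDl : left_distributive trop_mul trop_add.
Proof. by move=> [x|] [y|] [z|] //=; rewrite addr_maxl. Qed.

Fact trop_mul0 : left_zero None trop_mul.
Proof. by []. Qed.

End TropicalSemiring.

HB.instance Definition _ (R : realType) :=
  GRing.isNmodule.Build (tropical R)
    (@trop_addA R) (@trop_addC R) (@trop_add0 R).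

(* From here on, on [tropical R] and on square matrices over it, [+], [\sum],
   [*], [*m] and [^+] are the max-plus operations: 0 is -oo and 1 is the real
   number 0, so [1 : 'M[tropical R]_d] is the tropical identity matrix. *)
HB.instance Definition _ (R : realType) :=
  GRing.Nmodule_isComPzSemiRing.Build (tropical R)
    (@trop_mulA R) (@trop_mulC R) (@trop_mul1 R)
    (@trop_mulDl R) (@trop_mul0 R).

Section AdjointSemidirect.
Variables (R : realType) (d : nat).
Implicit Types (A B : 'M[tropical R]_d)
  (p q : 'M[tropical R]_d * 'M[tropical R]_d).

Definition adj_mul A B : 'M[tropical R]_d := A + B + A *m B.

(* Adjoint and semidirect powers start at exponent 1; exponent 0 is a junk
   value, equal to the first power. *)
Definition adj_exp A (k : nat) : 'M[tropical R]_d :=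
  iter k.-1 (fun B => adj_mul B A) A.

Definition semidirect_mul p q : 'M[tropical R]_d * 'M[tropical R]_d :=
  (adj_mul p.1 q.2 + q.1, adj_mul p.2 q.2).

Definition semidirect_exp p (k : nat) : 'M[tropical R]_d * 'M[tropical R]_d :=
  iter k.-1 (fun q => semidirect_mul q p) p.

End AdjointSemidirect.

(* Main.v *)
(** By idempotency the partial sums S_n = \sum_(i < n) H^i satisfy
    S_n + S_n H + 1 = S_(n+1). The first component of the semidirect power obeys
    M_(k+1) = M_k + M_k H + H + M, so both of its summands M S_k and H S_(k-1)
    are advanced by this identity, the stray terms H and M playing the role of
    the 1. *)
Require Import Defs.
From mathcomp Require Import all_boot all_order all_algebra.
From mathcomp Require Import reals.

Import GRing.Theory.
Local Open Scope ring_scope.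

Lemma trop_mx_addxx (R : realType) (m n : nat) (A : 'M[tropical R]_(m, n)) :
  A + A = A.
Proof.
apply/matrixP=> i j; rewrite mxE.
by case: (A i j) => [x|] //; congr Some; exact: Order.POrderTheory.maxxx.
Qed.

Lemma trop_geometric_sumS (R : realType) (d : nat) (H : 'M[tropical R]_d)
    (n : nat) :
  let S n := \sum_(0 <= i < n) H ^+ i in S n + S n *m H + 1 = S n.+1.
Proof.
move=> S.
have shift : S n *m H + 1 = S n.+1.
  rewrite /S big_nat_recl // expr0 addrC mulmx_suml; congr (_ + _).
  by apply: eq_bigr => i _; rewrite exprSr.
(* [shift] leaves [S n + S n.+1]; splitting off the top power [H ^+ n] exposes a second [S n], which
   idempotency absorbs. *)
by rewrite -addrA shift /S big_nat_recr //= addrA trop_mx_addxx.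
Qed.

(** The induction can start at exponent 1: there the second sum is empty, hence the all -oo
    matrix. *)
Lemma semidirect_expS (R : realType) (d : nat) (M H : 'M[tropical R]_d)
    (n : nat) :
  semidirect_exp (M, H) n.+1 =
    (M *m (\sum_(0 <= i < n.+1) H ^+ i) + H *m (\sum_(0 <= i < n) H ^+ i),
     adj_exp H n.+1).
Proof.
elim: n => [|n IHn].
  by rewrite big_nat1 big_geq // mulmx0 addr0 expr0 mulmx1.
transitivity (semidirect_mul (semidirect_exp (M, H) n.+1) (M, H)); first by [].
rewrite IHn /semidirect_mul /adj_mul; congr (_, _); rewrite [LHS]/=.
rewrite -[X in _ = M *m X + _]trop_geometric_sumS.
rewrite -[X in _ = _ + H *m X]trop_geometric_sumS.
rewrite !mulmxDr mulmxDl !mulmxA !mulmx1.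
(* With S and T the sums up to [n.+1] and [n], the summands come in the order MS, HT, H, MSH, HTH,
   M; they are regrouped by left factor, M or H. *)
by rewrite [LHS](AC (2*1*2*1) ((1*4*6)*(2*5*3))).
Qed.

Theorem proposition3p2 (R : realType) (d : nat) (M H : 'M[tropical R]_d)
    (k : nat) (hk : (2 <= k)%N) :
  semidirect_exp (M, H) k =
    (M *m (\sum_(0 <= i < k) H ^+ i) + H *m (\sum_(0 <= i < k.-1) H ^+ i),
     adj_exp H k).
Proof. by case: k hk => // n _; exact: semidirect_expS. Qed.
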